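(* Assume $MA(\omega_1)$. Then for any pair of ladder systems $L_1$ and $L_2$ (on stationary sets $S,T\subseteq \mathrm{Lim}(\omega_1)$, respectively), the product $X_{L_1}\times X_{L_2}$ is hereditarily normal.
   Context: $MA(\omega_1)$ is Martin's Axiom for families of $\omega_1$ dense sets in ccc posets. $\mathrm{Lim}(\omega_1)$ is the set of countable limit ordinals. A ladder system on a stationary set $S\subseteq \mathrm{Lim}(\omega_1)$ is a family $L=\{s_\alpha:\alpha\in S\}$ where each $s_\alpha$ is (the range of) an $\omega$-sequence of elements of $\alpha$ cofinal in $\alpha$. The space $X_L$ has underlying set $(\omega_1\times\{0\})\cup(S\times\{1\})$; every point $(\alpha,0)$ is isolated, and for $\alpha\in S$ a basic neighborhood of $(\alpha,1)$ consists of $\{(\alpha,1)\}$ together with a cofinite subset of $s_\alpha\times\{0\}$. *)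

(* Defs.v *)
From HB Require Import structures.
From mathcomp Require Import all_boot all_order.
From mathcomp Require Import all_classical.
From mathcomp Require Import topology.

Set Implicit Arguments.
Unset Strict Implicit.
Unset Printing Implicit Defensive.

Import Order.TTheory.
Local Open Scope classical_set_scope.
Local Open Scope order_scope.

(** The ordinal omega_1, up to order isomorphism: an uncountable well-order all
    of whose proper initial segments are countable. *)
Definition is_omega1 (d : Order.disp_t) (W : orderType d) : Prop :=
  [/\ wochoice.well_order (<=%O : rel W),
      ~ countable [set: W]
    & forall a : W, countable [set b | b < a] ].

Section Forcing.
Context (d : Order.disp_t) (P : porderType d).
Implicit Types (p q r : P) (A D G : set P).

(** Stronger conditions are smaller. *)
Definition compatible p q := exists2 r, r <= p & r <= q.

Definition antichain A :=
  forall p q, A p -> A q -> p != q -> ~ compatible p q.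

Definition ccc := forall A, antichain A -> countable A.

Definition dense_below D := forall p, exists2 q, D q & q <= p.

Definition poset_filter G :=
  [/\ G !=set0,
      forall p q, G p -> p <= q -> G q
    & forall p q, G p -> G q -> exists r, [/\ G r, r <= p & r <= q] ].

End Forcing.

(** MA(omega_1); [W] is omega_1, and serves only to index the family of dense
    sets. *)
Definition MA_omega1 (W : Type) : Prop :=
  forall (d : Order.disp_t) (P : porderType d),
    [set: P] !=set0 -> ccc P ->
    forall D : W -> set P, (forall a, dense_below (D a)) ->
      exists2 G : set P, poset_filter G & forall a, G `&` D a !=set0.

Section Stationary.
Context (d : Order.disp_t) (W : orderType d).
Implicit Types (a b c : W) (C S : set W).

(** The least element of [W] is not a limit. *)
Definition is_limit a :=
  (exists b, b < a) /\ (forall b, b < a -> exists2 c, b < c & c < a).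

Definition Lim : set W := [set a | is_limit a].

Definition club C :=
  (forall a, is_limit a ->
     (forall b, b < a -> exists c, [/\ C c, b < c & c < a]) -> C a)
  /\ (forall a, exists2 c, C c & a < c).

Definition stationary S := forall C, club C -> S `&` C !=set0.

(** [s] is the range of a strictly increasing sequence cofinal in [a]. *)
Definition is_ladder a (s : set W) :=
  exists u : nat -> W,
    [/\ forall m n, (m < n)%N -> u m < u n,
        forall n, u n < a,
        forall b, b < a -> exists n, b <= u n
      & s = range u].

Record ladder_system (S : set W) := LadderSystem {
  ladder :> S -> set W;
  ladderP : forall a : S, is_ladder (\val a) (ladder a) }.

End Stationary.

(** The underlying set of X_L: [pt0 a] is (a, 0) and [pt1 a] is (a, 1). *)
Variant ladder_space (d : Order.disp_t) (W : orderType d) (S : set W)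
  (L : ladder_system S) : Type := pt0 of W | pt1 of S.

Section LadderSpace.
Context (d : Order.disp_t) (W : orderType d) (S : set W) (L : ladder_system S).
Local Notation X := (ladder_space L).

HB.instance Definition _ := gen_eqMixin X.
HB.instance Definition _ := gen_choiceMixin X.

(** The basic neighbourhood {(a, 1)} U ((s_a \ F) x {0}), for [F] finite. *)
Definition ladder_basic (a : S) (F : set W) : set X :=
  [set pt1 L a] `|` [set pt0 L b | b in L a `\` F].

Definition ladder_nbhs (x : X) : set_system X :=
  match x with
  | pt0 _ => [set U | U x]
  | pt1 a => filter_from finite_set (ladder_basic a)
  end.

HB.instance Definition _ := hasNbhs.Build X ladder_nbhs.

Let nbhs_filter (x : X) : ProperFilter (nbhs x).
Proof.
case: x => [a|a].
  apply: Build_ProperFilter_ex; first by move=> U Ux; exists (pt0 L a).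
  by split => [//|U V Ux Vx|U V UV Ux]; [exact: (conj Ux Vx)|exact: UV].
apply: filter_from_proper; last first.
  by move=> F _; exists (pt1 L a); left.
apply: filter_from_filter; first by exists set0; exact: finite_set0.
move=> F G finF finG; exists (F `|` G); first by rewrite finite_setU.
move=> y [->|[b [Lb /not_orP[Fb Gb]] <-]]; first by split; left.
by split; right; exists b.
Qed.

Let nbhs_singleton (x : X) (U : set X) : nbhs x U -> U x.
Proof. by case: x => [//|a] [F _ FU]; apply: FU; left. Qed.

Let nbhs_nbhs (x : X) (U : set X) : nbhs x U -> nbhs x (nbhs^~ U).
Proof.
case: x => [//|a] [F finF FU]; exists F => // y [->|[b Lb <-]].
  by exists F.
by apply: FU; right; exists b.
Qed.

HB.instance Definition _ :=
  Nbhs_isNbhsTopological.Build X nbhs_filter nbhs_singleton nbhs_nbhs.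

End LadderSpace.

Definition hereditarily_normal (T : topologicalType) : Prop :=
  forall A : set T, normal_space (set_type A).

(* Main.v *)
From HB Require Import structures.
Require Import Defs.
From mathcomp Require Import all_boot all_order.
From mathcomp Require Import all_classical.
From mathcomp Require Import topology.

(** A space is hereditarily normal as soon as any two separated sets [P] and
    [Q] (each disjoint from the closure of the other) have disjoint open
    neighbourhoods, so it is enough to build these in the product.

    The natural forcing does it: a condition is a pair [(U, V)] of disjoint
    finite unions of basic clopen sets with [U] missing [Q] and [V] missing
    [P], ordered by reverse inclusion.  As conditions are clopen and [P], [Q]
    are separated, any given point of [P] can be added to [U] and any point of
    [Q] to [V]; this is one dense set per point, and the space has only omega_1
    points.  The unions of the first and of the second components over a
    generic filter are then the required neighbourhoods.

    Everything rests on the countable chain condition.  Measure a point of a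
    ladder space by its ordinal, and a point of a product by the larger of the
    two.  A basic set [N] attached to [alpha] consists of [alpha] and of a tail
    of a ladder, so it has a gap below every limit [l] other than [alpha]: all
    the points of [N] below [l] lie below a single [g < l] (if [alpha < l]
    because [N] lies below [alpha], if [l < alpha] because a ladder on [alpha]
    meets [l] in a finite set).  Finite unions and boxes inherit this, with
    finitely many exceptional [l].  Moreover, for each [g] there are only
    countably many traces of such sets on the points below [g].

    Given an uncountable set of conditions, all but finitely many [l] are
    non-exceptional for uncountably many of its members.  Take such an [l]
    which is also closed in the following sense: for cofinally many [c < l],
    every trace below [c] of a member is the trace of a member bounded below
    [l].  Now pick a member [p] that is not exceptional at [l] and a bounded
    [q] having the same trace as [p] below [c], where [c] is above the gap of
    [p].  A point shared by a component of [p] and a component of [q] lies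
    below [l], hence below [c], and there [q] looks just like [p], whose two
    components are disjoint.  So [p] and [q] are compatible.

    The properties used are gathered in [slim_base]; they hold for ladder
    spaces ([slim_ladder_base]) and pass to products ([slim_base_prod]) and to
    finite unions ([slim_base_fin_union]).  The chain condition is
    [separation_ccc], and the forcing argument is [MA_separated]. *)

Set Implicit Arguments.
Unset Strict Implicit.
Unset Printing Implicit Defensive.

Import Order.TTheory.
Local Open Scope order_scope.
Local Open Scope classical_set_scope.

(** * Suprema and closure points in omega_1 *)

Section Omega1.
Context (d : Order.disp_t) (W : orderType d).
Context (omega1W : is_omega1 W).
Implicit Types (a b c l : W) (C : set W).

Lemma omega1_min C : C !=set0 -> exists2 m, C m & forall a, C a -> m <= a.
Proof.
have [wo _ _] := omega1W => -[a Ca].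
have [|m [[mC lbm] _]] := wo [pred x | x \in C]; first by exists a; rewrite !inE.
by exists m => [|b Cb]; [move: mC; rewrite !inE|apply: lbm; rewrite !inE].
Qed.

Lemma omega1_countable_le a : countable [set b | b <= a].
Proof.
have [_ _ cnt] := omega1W.
rewrite (_ : [set b | b <= a] = [set b | b < a] `|` [set a]).
  by rewrite -bigcup2E; apply: bigcup_countable => // -[|[|i]] _ //=.
apply/seteqP; split=> b /=; rewrite le_eqVlt.
  by case/orP => [/eqP ->|]; [right|left].
by case=> [->|->]; rewrite ?eqxx ?orbT.
Qed.

(** Otherwise omega_1 would be the union of the countably many countable initial
    segments that end in [C]. *)
Lemma omega1_bound C : countable C -> exists a, forall c, C c -> c < a.
Proof.
have [_ unc _] := omega1W => cC.
have [//|h] := pselect (exists a, forall c, C c -> c < a).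
exfalso; apply: unc; rewrite (_ : setT = \bigcup_(c in C) [set b | b <= c]).
  by apply: bigcup_countable => // c _; exact: omega1_countable_le.
apply/seteqP; split=> // a _; apply: contrapT => nh; apply: h; exists a => c Cc.
by rewrite ltNge; apply/negP => ac; apply: nh; exists c.
Qed.

Lemma omega1_least_bound C : countable C -> C !=set0 ->
  exists2 l, (forall c, C c -> c < l) & forall b, b < l -> exists2 c, C c & b <= c.
Proof.
move=> cC C0; have [|l ubl minl] := @omega1_min [set a | forall c, C c -> c < a].
  exact: omega1_bound.
exists l => // b bl; apply: contrapT => nh; move: bl; rewrite ltNge => /negP; apply.
apply: minl => c Cc; rewrite ltNge; apply/negP => bc; apply: nh; by exists c.
Qed.

(** The limit of the iterates of [g] from [a]. *)
Lemma omega1_closed (g : W -> W) a : (forall b, b < g b) ->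
  exists l, [/\ is_limit l, a < l
    & forall b, b < l -> exists2 c, b <= c & g c < l].
Proof.
move=> ltg; pose u n := iter n g a.
have [||l ubl cofl] := @omega1_least_bound (range u).
- by apply: sub_countable (card_image_le _ _) _.
- by exists (u 0), 0%N.
have al : a < l by apply: ubl; exists 0%N.
have gl n : g (u n) < l by apply: ubl; exists n.+1.
exists l; split => // [|b /cofl[c [n _ <-] bc]]; last by exists (u n).
split; first by exists a.
move=> b /cofl[c [n _ <-] bc]; exists (g (u n)) => //.
exact: le_lt_trans (ltg _).
Qed.

Lemma omega1_succ : exists s : W -> W, forall a b, (b < s a) = (b <= a).
Proof.
have /choice[s sP] : forall a, exists c, forall b, (b < c) = (b <= a).
  move=> a; have [||c ubc cofc] := @omega1_least_bound [set a].
  - exact: countable1.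
  - by exists a.
  exists c => b; apply/idP/idP => [/cofc[_ ->]//|ba].
  by apply: le_lt_trans ba _; exact: ubc.
by exists s.
Qed.

(** A space with countable initial segments has at most omega_1 points.  An
    ordinal determines at most one pair of a limit [l] and a natural number [n]
    such that it is [l + n]; let it stand for the [n]-th point of height at most
    [l].  Since limits are unbounded, every point is reached. *)
Lemma omega1_enum (Z : Type) (h : Z -> W) :
  (forall a, countable [set z | h z <= a]) ->
  exists e : W -> option Z, forall z, exists a, e a = Some z.
Proof.
move=> cZ; have [s sP] := omega1_succ.
have lts a : a < s a by rewrite sP.
have s_inj : injective s.
  by move=> a b sab; apply/le_anti; rewrite -!sP -sab lts sab lts.
have limNs l a : is_limit l -> l <> s a.
  move=> [_ liml] lsa; have [|c ac] := liml a; first by rewrite lsa.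
  by rewrite lsa sP leNgt ac.
have uniq_limit n m l k : is_limit l -> is_limit k ->
    iter n s l = iter m s k -> n = m /\ l = k.
  move=> Ll Lk; elim: n m => [|n IH] [|m] //= E.
  - by case: (limNs l _ Ll E).
  - by case: (limNs k _ Lk (esym E)).
  - by case: (IH m (s_inj _ _ E)) => -> ->.
have /choice[f fP] : forall a, exists f : Z -> nat,
    {in [set z | h z <= a] &, injective f}.
  by move=> a; apply/countable_injP.
(* [code a z l]: [a] is [l + n] for the index [n] of [z] at the limit [l] *)
pose code a z l := [/\ is_limit l, h z <= l & a = iter (f l z) s l].
have /choice[e eP] : forall a, exists o : option Z,
    forall z l, code a z l -> o = Some z.
  move=> a; have [[z [l [Ll zl ->]]]|no] := pselect (exists z l, code a z l).
    exists (Some z) => y k [Lk yk E].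
    have [fE lk] := uniq_limit _ _ _ _ Ll Lk E; congr Some.
    by move: yk fE; rewrite -lk => yl fE; apply: (fP l); rewrite ?inE.
  by exists None => z l c; case: no; exists z, l.
exists e => z; have [l [Ll zl _]] := omega1_closed (h z) lts.
by exists (iter (f l z) s l); apply: (eP _ _ l); split=> //; exact: ltW.
Qed.

End Omega1.

(** * Slim bases *)

(** [h] stratifies the space into countable initial segments indexed by omega_1,
    and [B] is a base of clopen sets.  [slim_gap] is the combinatorial core: it
    says that a member of [B] accumulates (in height) from below at finitely
    many limits only.  With [slim_trace], which bounds the number of local
    shapes, it is what makes the forcing satisfy the countable chain condition. *)
Record slim_base (d : Order.disp_t) (W : orderType d) (Z : topologicalType)
    (h : Z -> W) (B : set_system Z) : Prop := SlimBase {
  slim_countable : forall g, countable [set z | h z <= g];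
  slim_clopen : forall N, B N -> clopen N;
  slim_basis : forall z U, nbhs z U -> exists N, [/\ B N, N z & N `<=` U];
  slim_bounded : forall N, B N -> exists g, N `<=` [set z | h z <= g];
  slim_gap : forall N, B N -> exists2 F : set W, finite_set F &
    forall l, is_limit l -> ~ F l ->
      exists2 g, g < l & forall z, N z -> h z < l -> h z <= g;
  slim_trace : forall g, countable [set N `&` [set z | h z <= g] | N in B] }.

Inductive fin_union (Z : Type) (B : set_system Z) : set_system Z :=
| fin_union0 : fin_union B set0
| fin_unionS N U : B N -> fin_union B U -> fin_union B (N `|` U).

Lemma fin_unionU (Z : Type) (B : set_system Z) (U V : set Z) :
  fin_union B U -> fin_union B V -> fin_union B (U `|` V).
Proof.
move=> BU BV; elim: BU => [|N U' BN _ IH]; first by rewrite set0U.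
by rewrite -setUA; exact: fin_unionS.
Qed.

Section SlimBase.
Context (d : Order.disp_t) (W : orderType d).

(** Conditions are finite unions of basic sets; with this lemma the base can be
    taken to be closed under unions. *)
Lemma slim_base_fin_union (Z : topologicalType) (h : Z -> W) (B : set_system Z) :
  is_omega1 W -> slim_base h B -> slim_base h (fin_union B).
Proof.
move=> omega1W [cZ clB basB bdB gapB trB]; split=> //.
- move=> U; elim => [|N V BN _ cV]; first exact: clopen0.
  exact: clopenU (clB _ BN) cV.
- move=> z U /basB[N [BN Nz NU]]; exists N; split => //.
  by rewrite -(setU0 N); apply: fin_unionS => //; exact: fin_union0.
- move=> U; elim => [|N V BN _ [g Vg]].
    have [_ unc _] := omega1W; have [[a _]|noW] := pselect ([set: W] !=set0).
      by exists a.
    by case: unc; rewrite (_ : setT = set0)//; apply/seteqP; split=> // a _;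
       case: noW; exists a.
  have [g' Ng] := bdB _ BN; exists (Order.max g g') => z.
  by case=> [/Ng|/Vg]/= zg; rewrite le_max zg ?orbT.
- move=> U; elim => [|N V BN _ [F fF FP]].
    exists set0; first exact: finite_set0.
    by move=> l [[b bl] _] _; exists b.
  have [G fG GP] := gapB _ BN; exists (F `|` G); first by rewrite finite_setU.
  move=> l Ll /not_orP[Fl Gl].
  have [a al aP] := FP l Ll Fl; have [b bl bP] := GP l Ll Gl.
  exists (Order.max a b); first by rewrite gt_max al bl.
  by move=> z [Nz|Vz] zl; rewrite le_max ?(bP _ Nz zl) ?(aP _ Vz zl) ?orbT.
(* the trace of a finite union is the union of a finite set of traces, and a
   countable set has countably many finite subsets *)
- move=> g; pose Tr := [set N `&` [set z | h z <= g] | N in B].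
  have cTr : countable [set \bigcup_(t in F) t | F in
      [set F | F `<=` Tr /\ finite_set F]].
    apply: sub_countable (card_image_le _ _) _.
    exact: countable_finite_subset (trB g).
  apply: sub_countable cTr; apply: subset_card_le => _ [U + <-].
  elim => [|N V BN _ [F [FTr fF] FE]].
    exists set0; last by rewrite bigcup_set0 set0I.
    by split=> //; exact: finite_set0.
  exists ([set N `&` [set z | h z <= g]] `|` F).
    split; last by rewrite finite_setU; split=> //; exact: finite_set1.
    by move=> t [->|/FTr//]; exists N.
  by rewrite bigcup_setU bigcup_set1 FE setIUl.
Qed.

(** With the maximum as height, the points of height at most [g] form a box, so
    that traces of boxes are boxes of traces; and a gap of [N `*` M] is the
    larger of the gaps of [N] and [M]. *)
Lemma slim_base_prod (Y Z : topologicalType) (hY : Y -> W) (hZ : Z -> W) BY BZ :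
  slim_base hY BY -> slim_base hZ BZ ->
  slim_base (fun x : Y * Z => Order.max (hY x.1) (hZ x.2))
            [set N `*` M | N in BY & M in BZ].
Proof.
move=> [cY clY basY bdY gapY trY] [cZ clZ basZ bdZ gapZ trZ].
have boxE g : [set x : Y * Z | Order.max (hY x.1) (hZ x.2) <= g] =
    [set y | hY y <= g] `*` [set z | hZ z <= g].
  by apply/seteqP; split=> x /=; rewrite ge_max => /andP.
split=> //.
- by move=> g; rewrite boxE; exact: countableX.
- move=> _ [N BN [M BM <-]].
  apply: (clopenI (A := fst @^-1` N) (B := snd @^-1` M)).
    by apply: preimage_clopen (clY _ BN) _ => x; exact: cvg_fst.
  by apply: preimage_clopen (clZ _ BM) _ => x; exact: cvg_snd.
- move=> [y z] U [[P Q] /= [Py Qz] PQU].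
  have [N [BN Ny NP]] := basY _ _ Py; have [M [BM Mz MQ]] := basZ _ _ Qz.
  exists (N `*` M); split=> //; first by exists N => //; exists M.
  by move=> [y' z'] [/= Ny' Mz']; apply: PQU; split; [exact: NP|exact: MQ].
- move=> _ [N BN [M BM <-]].
  have [a Na] := bdY _ BN; have [b Mb] := bdZ _ BM.
  exists (Order.max a b) => x [/Na /= xa /Mb /= xb].
  by rewrite ge_max !le_max xa xb orbT.
- move=> _ [N BN [M BM <-]].
  have [F fF FP] := gapY _ BN; have [G fG GP] := gapZ _ BM.
  exists (F `|` G); first by rewrite finite_setU.
  move=> l Ll /not_orP[Fl Gl].
  have [a al aP] := FP l Ll Fl; have [b bl bP] := GP l Ll Gl.
  exists (Order.max a b); first by rewrite gt_max al bl.
  move=> x [Nx Mx]; rewrite gt_max => /andP[xl1 xl2].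
  by rewrite ge_max !le_max (aP _ Nx xl1) (bP _ Mx xl2) orbT.
- move=> g; have := countableX (trY g) (trZ g).
  set D := (X in countable X) => cD.
  have : countable [set p.1 `*` p.2 | p in D].
    exact: sub_countable (card_image_le _ _) cD.
  apply: sub_countable; apply: subset_card_le => _ [_ [N BN [M BM <-]] <-].
  exists (N `&` [set y | hY y <= g], M `&` [set z | hZ z <= g]).
    by split; [exists N|exists M].
  by rewrite boxE setXI.
Qed.

End SlimBase.

(** * Ladder spaces are slim *)

Section Ladder.
Context (d : Order.disp_t) (W : orderType d).
Implicit Types (a b c g l : W).

Lemma limit_bound_finite l (F : set W) : is_limit l -> finite_set F ->
  exists2 g, g < l & forall b, F b -> b < l -> b <= g.
Proof.
move=> [[a al] _] /finite_seqP[s ->]; elim: s => [|b s [g gl gP]].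
  by exists a => // b; rewrite /= in_nil.
have [bl|lb] := ltP b l; last first.
  exists g => // c /=; rewrite inE => /orP[/eqP ->|cs cl]; first by rewrite ltNge lb.
  exact: gP.
exists (Order.max b g); first by rewrite gt_max bl gl.
move=> c /=; rewrite inE le_max => /orP[/eqP ->|cs cl]; first by rewrite lexx.
by rewrite (gP c cs cl) orbT.
Qed.

Lemma ladder_lt a (s : set W) b : is_ladder a s -> s b -> b < a.
Proof. by move=> [u [_ ua _ ->]] [n _ <-]. Qed.

Lemma finite_ladder_lt a (s : set W) c : is_ladder a s -> c < a ->
  finite_set (s `&` [set b | b < c]).
Proof.
move=> [u [u_mono _ u_cof ->]] /u_cof[n cun].
apply: (@sub_finite_set _ _ (u @` `I_n)); last exact/finite_image/finite_II.
move=> _ [[m _ <-] /= umc]; exists m => //=; rewrite ltnNge; apply/negP => nm.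
have : u m < u n by exact: lt_le_trans cun.
apply/negP; rewrite -leNgt; move: nm; rewrite leq_eqVlt => /orP[/eqP->//|nm].
exact/ltW/u_mono.
Qed.

Lemma ladder_limit a (s : set W) : is_ladder a s -> is_limit a.
Proof.
move=> [u [u_mono ua u_cof _]]; split; first by exists (u 0%N).
move=> b /u_cof[n bun]; exists (u n.+1) => //.
exact: le_lt_trans bun (u_mono _ _ _).
Qed.

Context (S : set W) (L : ladder_system S).
Local Notation X := (ladder_space L).

Definition ladder_height (x : X) : W :=
  match x with pt0 a => a | pt1 s => \val s end.

(** A basic neighbourhood of [(s, 1)] in which the finite set removed from the
    ladder is its part below [c].  Indexing by [c] instead of by finite sets
    makes it plain that there are countably many cones at each point. *)
Definition ladder_cone (s : S) (c : W) : set X :=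
  [set pt1 L s] `|` [set pt0 L b | b in L s `&` [set b | c <= b]].

Definition ladder_base : set_system X :=
  range (fun a => [set pt0 L a]) `|`
  [set ladder_cone sc.1 sc.2 | sc in [set sc : S * W | sc.2 < \val sc.1]].

Lemma open_ladder (U : set X) :
  (forall s, U (pt1 L s) -> exists2 F, finite_set F & ladder_basic s F `<=` U) ->
  open U.
Proof.
move=> UP; rewrite openE => -[a|s] Us //.
by have [F fF FU] := UP s Us; exists F.
Qed.

Lemma clopen_pt0 a : clopen [set pt0 L a].
Proof.
split; first by apply: open_ladder => s.
rewrite -(setCK [set _]); apply/open_closedC/open_ladder => s _.
exists [set a]; first exact: finite_set1.
by move=> x [->//|[b [_ ba] <-] [/ba]].
Qed.

(** Below the smaller of the two ordinals, the ladder on the larger one is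
    finite. *)
Lemma finite_ladderI (s t : S) : s <> t -> finite_set (L s `&` L t).
Proof.
wlog st : s t / \val s < \val t => [wl st|_].
  have /orP[|] : (\val s < \val t) || (\val t < \val s).
  - by rewrite -neq_lt; apply/eqP => /val_inj.
  - by move/wl; apply.
  - by rewrite setIC => /wl; apply => /esym.
apply: sub_finite_set (finite_ladder_lt (ladderP L t) st) => b [sb tb].
by split=> //=; exact: ladder_lt (ladderP L s) sb.
Qed.

Lemma clopen_ladder_cone (s : S) c : c < \val s -> clopen (ladder_cone s c).
Proof.
move=> cs; split.
  apply: open_ladder => t [[->]|[b _]//].
  exists (L s `&` [set b | b < c]); first exact: finite_ladder_lt (ladderP L s) cs.
  move=> x [->|[b [sb nbc] <-]]; first by left.
  right; exists b => //; split=> //=; rewrite leNgt; apply/negP => bc.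
  exact: nbc.
rewrite -(setCK (ladder_cone s c)); apply/open_closedC/open_ladder => t nt.
exists (L s `&` L t).
  by apply: finite_ladderI => st; apply: nt; left; rewrite st.
move=> x [->//|[b [tb nst] <-]] [//|[b' [sb' _] [bb']]].
by apply: nst; rewrite -bb'; split=> //; rewrite bb'.
Qed.

Lemma ladder_cone_basis (s : S) (F : set W) : finite_set F ->
  exists2 c, c < \val s & ladder_cone s c `<=` ladder_basic s F.
Proof.
move=> fF; have lim_s := ladder_limit (ladderP L s).
have [g gs gF] := limit_bound_finite lim_s fF.
have [c gc cs] := lim_s.2 g gs; exists c => //.
move=> x [->|[b [sb /= cb] <-]]; first by left.
right; exists b => //; split=> // /gF bg.
have := lt_le_trans gc cb; rewrite ltNge bg //.
exact: ladder_lt (ladderP L s) sb.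
Qed.

(** The only limit at which the cone of [s] accumulates is [s] itself.  The trace
    below [g] of a cone is the whole cone if [s <= g], and otherwise a finite set
    of isolated points: either way there are countably many choices. *)
Lemma slim_ladder_base : is_omega1 W -> slim_base ladder_height ladder_base.
Proof.
move=> omega1W; have cle := omega1_countable_le omega1W.
have cS g : countable [set s : S | \val s <= g].
  have /countable_injP[f f_inj] := cle g; apply/countable_injP.
  exists (f \o \val) => s t; rewrite !inE => sg tg /f_inj st.
  by apply/val_inj/st; rewrite inE.
split.
- move=> g; rewrite (_ : [set _ | _] =
      pt0 L @` [set a | a <= g] `|` pt1 L @` [set s | \val s <= g]).
    rewrite -bigcup2E; apply: bigcup_countable => // -[|[|i]] _ //=;
    exact: sub_countable (card_image_le _ _) _.
  apply/seteqP; split=> [[a|s] /= xg|_ [[a ag <-]|[s sg <-]]] //.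
    by left; exists a.
  by right; exists s.
- by move=> _ [[a _ <-]|[[s c] /= cs <-]];
    [exact: clopen_pt0|exact: clopen_ladder_cone].
- move=> [a|s] U.
    move=> Ua; exists [set pt0 L a]; split=> // [|_ ->//].
    by left; exists a.
  move=> [F fF FU]; have [c cs cF] := ladder_cone_basis s fF.
  exists (ladder_cone s c); split; [|by left|exact: subset_trans FU].
  by right; exists (s, c).
- move=> _ [[a _ <-]|[[s c] /= cs <-]].
    by exists a => _ -> /=.
  exists (\val s) => x [->|[b [sb _] <-]] /=; rewrite ?lexx//.
  exact/ltW/(ladder_lt (ladderP L s) sb).
- move=> _ [[a _ <-]|[[s c] /= cs <-]].
    exists set0; first exact: finite_set0.
    move=> l [[b bl] _] _; have [al|la] := ltP a l.
      by exists a => // _ ->.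
    by exists b => // _ -> /=; rewrite ltNge la.
  exists [set \val s]; first exact: finite_set1.
  move=> l Ll /= ls; have /orP[sl|{}ls] : (\val s < l) || (l < \val s).
  + by rewrite -neq_lt; apply/eqP => /esym.
  + exists (\val s) => // x [->|[b [sb _] <-]] _ /=; rewrite ?lexx//.
    exact/ltW/(ladder_lt (ladderP L s) sb).
  + have [g gl gP] := limit_bound_finite Ll (finite_ladder_lt (ladderP L s) ls).
    exists g => // x [->/=|[b [sb _] <-] /= bl]; last exact: gP.
    by rewrite ltNge (ltW ls).
- move=> g.
  (* the possible traces of cones with apex at most [g], and the finite traces *)
  pose D1 := [set ladder_cone sc.1 sc.2 | sc in
    [set s : S | \val s <= g] `*` [set c | c <= g]].
  pose D2 := [set pt0 L @` F | F in
    [set F | F `<=` [set a | a <= g] /\ finite_set F]].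
  have cD : countable (D1 `|` D2).
    rewrite -bigcup2E; apply: bigcup_countable => // -[|[|i]] _ //=.
      apply: sub_countable (card_image_le _ _) _; apply: countableX => //.
    apply: sub_countable (card_image_le _ _) _.
    exact: countable_finite_subset.
  apply: sub_countable cD; apply: subset_card_le.
  move=> _ [_ [[a _ <-]|[[s c] /= cs <-]] <-].
    right; exists ([set a] `&` [set b | b <= g]).
      split; first by move=> b [].
      exact/finite_setIl/finite_set1.
    apply/seteqP; split=> [_ [b [-> bg] <-]|_ [-> /= ag]]; first by [].
    by exists a.
  have [sg|gs] := leP (\val s) g.
    left; exists (s, c).
      by split=> //=; exact: le_trans (ltW cs) sg.
    apply/seteqP; split=> [x sx|x []//]; split=> //=.
    case: sx => [->|[b [sb _] <-]] //=.
    exact: le_trans (ltW (ladder_lt (ladderP L s) sb)) sg.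
  right; have [g' gg' g's] := (ladder_limit (ladderP L s)).2 g gs.
  exists (L s `&` [set b | c <= b] `&` [set b | b <= g]).
    split; first by move=> b [].
    apply: sub_finite_set (finite_ladder_lt (ladderP L s) g's).
    by move=> b [[sb _] /= bg]; split=> //=; exact: le_lt_trans gg'.
  apply/seteqP; split=> [_ [b [[sb cb] bg] <-]|x [[->/=|[b sb <-]] xg]].
  + by split=> //; right; exists b.
  + by move: xg; rewrite /= leNgt gs.
  + by exists b.
Qed.

End Ladder.

(** * Forcing with partial separations *)

(** A finite approximation, when the members of [B] are finite unions of basic
    sets, to a pair of disjoint neighbourhoods of [P] and [Q].  Requiring [sepL]
    to miss all of [Q], not only the part of [Q] treated so far, is what keeps
    every later point available. *)
Record separation (Z : Type) (B : set_system Z) (P Q : set Z) := Separation {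
  sepL : set Z;
  sepR : set Z;
  sepLB : B sepL;
  sepRB : B sepR;
  sepLR : sepL `&` sepR = set0;
  sepLQ : sepL `&` Q = set0;
  sepPR : P `&` sepR = set0 }.

Section SeparationOrder.
Context (Z : Type) (B : set_system Z) (P Q : set Z).
Local Notation cond := (separation B P Q).
Implicit Types p q r : cond.

HB.instance Definition _ := gen_eqMixin cond.
HB.instance Definition _ := gen_choiceMixin cond.

Lemma separation_eq p q : sepL p = sepL q -> sepR p = sepR q -> p = q.
Proof.
case: p q => [U V ? ? ? ? ?] [U' V' ? ? ? ? ?] /= UU VV; subst.
by congr Separation; exact: Prop_irrelevance.
Qed.

Definition separation_le : rel cond :=
  fun p q => `[< sepL q `<=` sepL p /\ sepR q `<=` sepR p >].

Lemma separation_le_refl : reflexive separation_le.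
Proof. by move=> p; apply/asboolP; split. Qed.

Lemma separation_le_anti : antisymmetric separation_le.
Proof.
move=> p q /andP[/asboolP[a b] /asboolP[a' b']].
by apply: separation_eq; apply/seteqP.
Qed.

Lemma separation_le_trans : transitive separation_le.
Proof.
move=> q p r /asboolP[a b] /asboolP[a' b']; apply/asboolP.
by split; [exact: subset_trans a|exact: subset_trans b].
Qed.

HB.instance Definition _ := Order.Le_isPOrder.Build (Order.Disp tt tt) cond
  separation_le_refl separation_le_anti separation_le_trans.

Lemma separation_leP p q :
  reflect (sepL q `<=` sepL p /\ sepR q `<=` sepR p) (p <= q).
Proof. exact: asboolP. Qed.

End SeparationOrder.

Lemma countable_representatives (T U : Type) (f : T -> U) (A : set T) :
  countable (f @` A) ->
  exists C, [/\ C `<=` A, countable C & forall p, A p -> exists2 q, C q & f q = f p].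
Proof.
move=> cfA; have [[t0 _]|T0] := pselect ([set: T] !=set0); last first.
  by exists set0; split=> // p; case: T0; exists p.
have /choice[r rP] : forall u, exists t, (f @` A) u -> A t /\ f t = u.
  move=> u; have [[t At ft]|nu] := pselect ((f @` A) u); first by exists t.
  by exists t0.
exists (r @` (f @` A)); split.
- by move=> _ [u Au <-]; case: (rP u Au).
- exact: sub_countable (card_image_le _ _) cfA.
move=> p Ap; have fAp : (f @` A) (f p) by exists p.
by exists (r (f p)); [exists (f p)|case: (rP _ fAp)].
Qed.

(** If the exceptional indices were infinitely many, then a member of [A] outside
    a countable union of countable sets would have all of them in its finite
    set. *)
Lemma uncountably_avoided (T I : Type) (A : set T) (F : T -> set I) :
  ~ countable A -> (forall t, A t -> finite_set (F t)) ->
  finite_set [set i | countable (A `&` [set t | ~ F t i])].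
Proof.
elim/Ppointed: I => I in F *; first by rewrite emptyE => _ _; exact: finite_set0.
move=> uncA finF; apply: contrapT => /infiniteP/pcard_leP[u].
apply: uncA; rewrite (_ : A = \bigcup_n (A `&` [set t | ~ F t (u n)])).
  by apply: bigcup_countable => // n _; exact: (@funS _ _ _ _ u n Logic.I).
apply/seteqP; split=> [t At|t [n _ []]//]; apply: contrapT => nt.
apply: infinite_nat; rewrite -(eq_finite_set (card_image u)).
apply: sub_finite_set (finF t At) => _ [n _ <-].
by apply: contrapT => nF; apply: nt; exists n.
Qed.

Section Forcing.
Context (d : Order.disp_t) (W : orderType d).
Context (omega1W : is_omega1 W).
Context (Z : topologicalType) (h : Z -> W) (B : set_system Z).
Context (slimB : slim_base h B).
Context (BU : forall U V, B U -> B V -> B (U `|` V)).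
Context (P Q : set Z).
Local Notation cond := (separation B P Q).
Local Notation below g := [set z | h z <= g].

Lemma compatible_separation (p q : cond) :
  sepL p `&` sepR q = set0 -> sepL q `&` sepR p = set0 -> compatible p q.
Proof.
case: p q => [U V bU bV UV UQ PV] [U' V' bU' bV' UV' UQ' PV'] /= e1 e2.
unshelve eexists (@Separation _ B P Q (U `|` U') (V `|` V') _ _ _ _ _).
- exact: BU.
- exact: BU.
- by rewrite setIUl !setIUr UV UV' e1 e2 !setU0.
- by rewrite setIUl UQ UQ' setU0.
- by rewrite setIUr PV PV' setU0.
- by apply/separation_leP; split=> x /=; left.
- by apply/separation_leP; split=> x /=; right.
Qed.

(** Two members of an uncountable set of conditions with the same trace below
    [c] are compatible when one has its gap at [l] below [c] and the other is
    bounded below [l], since the points they share then lie below [c]. *)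
Lemma separation_ccc : ccc cond.
Proof.
move=> A anti; apply: contrapT => uncA.
have gapP (p : cond) : exists F : set W, finite_set F /\ forall l, is_limit l ->
    ~ F l -> exists2 g, g < l &
      forall z, (sepL p `|` sepR p) z -> h z < l -> h z <= g.
  have [F fF FP] := slim_gap slimB (BU (sepLB p) (sepRB p)).
  by exists F.
have [F /all_and2[finF FP]] := choice gapP.
have [g0 g0P] : exists g0, forall l, countable (A `&` [set p | ~ F p l]) -> l < g0.
  apply: (omega1_bound omega1W); apply: finite_set_countable.
  exact: uncountably_avoided.
pose trace g (p : cond) := (sepL p `&` below g, sepR p `&` below g).
have cnt_trace g : countable (trace g @` A).
  have := countableX (slim_trace slimB g) (slim_trace slimB g).
  apply: sub_countable; apply: subset_card_le => _ [p _ <-].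
  by split; [exists (sepL p) => //; exact: sepLB|exists (sepR p) => //; exact: sepRB].
(* a countable set [C g] of members realizing all the traces below [g] *)
have [C CP] := choice (fun g => countable_representatives (cnt_trace g)).
have bdP (p : cond) : exists b, forall z, (sepL p `|` sepR p) z -> h z <= b.
  have [b bP] := slim_bounded slimB (BU (sepLB p) (sepRB p)).
  by exists b.
have [bd bdE] := choice bdP.
have /choice[G GP] : forall g, exists b, g < b /\ forall p, C g p -> bd p < b.
  move=> g; have [|b bP] := omega1_bound omega1W (C := [set g] `|` bd @` C g).
    rewrite -bigcup2E; apply: bigcup_countable => // -[|[|i]] _ //=.
    by apply: sub_countable (card_image_le _ _) _; case: (CP g).
  by exists b; split=> [|p Cp]; apply: bP; [left|right; exists p].
have [l [Ll g0l closed_l]] := omega1_closed omega1W g0 (fun b => (GP b).1).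
have uncl : ~ countable (A `&` [set p | ~ F p l]).
  by move=> /g0P; rewrite ltNge (ltW g0l).
(* [p] is taken outside of the representatives used below [l], so that the [q]
   found among them differs from [p] *)
have [p [[Ap pl] pnew]] : exists p, (A `&` [set p | ~ F p l]) p /\
    ~ (\bigcup_(c in [set c | c < l]) C c) p.
  apply: contrapT => nop; apply: uncl.
  have cC : countable (\bigcup_(c in [set c | c < l]) C c).
    have [_ _ cnt] := omega1W.
    by apply: bigcup_countable => // c _; case: (CP c).
  apply: sub_countable cC; apply: subset_card_le => p Ap.
  by apply: contrapT => nCp; apply: nop; exists p.
have [b bl bP] := FP p l Ll pl.
have [c bc Gcl] := closed_l b bl.
have cl : c < l by exact: lt_trans (GP c).1 Gcl.
have [CA _ /(_ p Ap)[q Cq [traceL traceR]]] := CP c.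
have pq : p != q by apply/eqP => pq; apply: pnew; exists c => //; rewrite pq.
apply: (anti p q Ap (CA _ Cq) pq).
have q_below z : (sepL q `|` sepR q) z -> h z < l.
  by move=> qz; apply: le_lt_trans (bdE q z qz) (lt_trans ((GP c).2 q Cq) Gcl).
have p_below z : (sepL p `|` sepR p) z -> h z < l -> below c z.
  by move=> pz zl; exact: le_trans (bP z pz zl) bc.
have disj U V V' : U `<=` sepL p `|` sepR p -> V' `<=` sepL q `|` sepR q ->
    U `&` V = set0 -> V' `&` below c = V `&` below c -> U `&` V' = set0.
  move=> Up V'q UV VV'; apply/seteqP; split=> // z [Uz V'z].
  have zc : below c z by apply: p_below (Up _ Uz) (q_below _ (V'q _ V'z)).
  rewrite -UV; split=> //; have : (V' `&` below c) z by [].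
  by rewrite VV' => -[].
apply: compatible_separation.
  apply: (disj _ (sepR p)) (sepLR p) traceR => z; [by left|by right].
rewrite setIC; apply: (disj _ (sepL p)) _ traceL => [z|z|]; [by right|by left|].
by rewrite setIC sepLR.
Qed.

Context (sepPQ : separated P Q).

(** The point [z] has a basic neighbourhood that avoids both [Q] and the closed
    set [sepR p]. *)
Lemma separation_extendL (z : Z) : P z ->
  dense_below [set p : cond | sepL p z].
Proof.
move=> Pz p; have [_ PclQ] := sepPQ.
have nQ : nbhs z (~` closure Q `&` ~` sepR p).
  apply: open_nbhs_nbhs; split.
    apply: openI; first exact/closed_openC/closed_closure.
    by apply/closed_openC; case: (slim_clopen slimB (sepRB p)).
  split=> [clQz|pz].
    by have : (P `&` closure Q) z by []; rewrite PclQ.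
  by have : (P `&` sepR p) z by []; rewrite sepPR.
have [N [BN Nz NQ]] := slim_basis slimB nQ.
unshelve eexists (@Separation _ B P Q (N `|` sepL p) (sepR p) _ _ _ _ _).
- exact: BU BN (sepLB p).
- exact: sepRB.
- rewrite setIUl sepLR setU0; apply/seteqP; split=> // y [/NQ[_ ny]] //.
- rewrite setIUl sepLQ setU0; apply/seteqP; split=> // y [/NQ[ny _]] Qy.
  by apply: ny; exact: subset_closure.
- exact: sepPR.
- by left.
- by apply/separation_leP; split=> // y; right.
Qed.

End Forcing.

Definition separation_swap (Z : Type) (B : set_system Z) (P Q : set Z)
    (p : separation B P Q) : separation B Q P :=
  Separation (sepRB p) (sepLB p) (etrans (setIC _ _) (sepLR p))
    (etrans (setIC _ _) (sepPR p)) (etrans (setIC _ _) (sepLQ p)).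

Lemma separation_extendR (d : Order.disp_t) (W : orderType d)
    (Z : topologicalType) (h : Z -> W) (B : set_system Z) (P Q : set Z) z :
  slim_base h B -> (forall U V, B U -> B V -> B (U `|` V)) ->
  separated P Q -> Q z -> dense_below [set p : separation B P Q | sepR p z].
Proof.
rewrite separatedC => slimB BU sepQP Qz p.
have [q qz /separation_leP[qL qR]] :=
  separation_extendL slimB BU sepQP Qz (separation_swap p).
by exists (separation_swap q) => //; apply/separation_leP.
Qed.

(** One dense set for each [a] in omega_1: it asks that the point numbered [a],
    if it belongs to [P] or to [Q], be put on the corresponding side. *)
Lemma MA_separated (d : Order.disp_t) (W : orderType d)
    (Z : topologicalType) (h : Z -> W) (B : set_system Z) (P Q : set Z) :
  is_omega1 W -> MA_omega1 W -> slim_base h B -> separated P Q ->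
  exists U V, [/\ open U, open V, P `<=` U, Q `<=` V & U `&` V = set0].
Proof.
move=> omega1W MA /(slim_base_fin_union omega1W) slimB sepPQ.
have B0 := fin_union0 B; have BU := @fin_unionU _ B.
set F := fin_union B in slimB B0 BU; pose cond := separation F P Q.
have ext z : P z \/ Q z ->
    dense_below [set p : cond | P z /\ sepL p z \/ Q z /\ sepR p z].
  case=> [Pz|Qz] p.
    have [q qz qp] := separation_extendL slimB BU sepPQ Pz p.
    by exists q => //; left.
  have [q qz qp] := separation_extendR slimB BU sepPQ Qz p.
  by exists q => //; right.
have [e e_surj] := omega1_enum omega1W (slim_countable slimB).
pose D a : set cond := [set p | forall z, e a = Some z -> P z \/ Q z ->
  P z /\ sepL p z \/ Q z /\ sepR p z].
have denseD a : dense_below (D a).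
  move=> p; rewrite /D; case: (e a) => [z|]; last by exists p.
  have [PQz|nPQz] := pselect (P z \/ Q z); last by exists p => // _ [<-].
  by have [q qz qp] := ext z PQz p; exists q => // _ [<-].
have cccPQ := @separation_ccc _ _ omega1W _ _ _ slimB BU P Q.
have [|G [_ _ Gdir] GD] := MA _ cond _ cccPQ D denseD.
  unshelve eexists (@Separation _ F P Q set0 set0 _ _ _ _ _) => //;
  by rewrite ?set0I ?setI0.
have PQ0 := separated_disjoint sepPQ.
have clopenF N : F N -> open N by move=> /(slim_clopen slimB)[].
exists (\bigcup_(p in G) sepL p), (\bigcup_(p in G) sepR p); split.
- by apply: bigcup_open => p _; apply: clopenF; exact: sepLB.
- by apply: bigcup_open => p _; apply: clopenF; exact: sepRB.
- move=> z Pz; have [a eaz] := e_surj z.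
  have [p [Gp /(_ z eaz (or_introl Pz))[[_ pz]|[Qz _]]]] := GD a.
    by exists p.
  by have : (P `&` Q) z by []; rewrite PQ0.
- move=> z Qz; have [a eaz] := e_surj z.
  have [p [Gp /(_ z eaz (or_intror Qz))[[Pz _]|[_ pz]]]] := GD a.
    by have : (P `&` Q) z by []; rewrite PQ0.
  by exists p.
- apply/seteqP; split=> // z [[p Gp pz] [q Gq qz]].
  have [r [_ /separation_leP[rpL _] /separation_leP[_ rqR]]] := Gdir p q Gp Gq.
  by rewrite -(sepLR r); split; [exact: rpL|exact: rqR].
Qed.

(** For [C] closed in the subspace [A] and [O'] open around [C], the sets [C] and
    [A `\` O'] are separated in the whole space, although their closures there
    may meet. *)
Lemma hereditarily_normal_separated (Z : topologicalType) :
  (forall P Q : set Z, separated P Q ->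
    exists U V, [/\ open U, open V, P `<=` U, Q `<=` V & U `&` V = set0]) ->
  hereditarily_normal Z.
Proof.
move=> sepZ A C closedC O /set_nbhsP[O' [openO' CO' O'O]].
pose P : set Z := val @` C; pose Q : set Z := val @` (~` O').
have trace_closure (E : set A) x : closure (val @` E : set Z) (val x) -> closure E x.
  move=> clE U; rewrite nbhsE => -[_ [[V openV <-] Vx] VU].
  have [|_ [[y Ey <-] Vy]] := clE V; first exact: open_nbhs_nbhs.
  by exists y; split=> //; exact: VU.
have [|U [V [openU openV PU QV UV]]] := sepZ P Q.
  split; apply/seteqP; split=> // z.
    move=> [clP [y nO'y yz]]; apply: nO'y; apply: CO'.
    by rewrite (closure_id C).1 //; apply: trace_closure; rewrite yz.
  move=> [[y Cy yz] clQ].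
  have : (~` O') y; last by apply; exact: CO'.
  rewrite (closure_id (~` O')).1; last exact: open_closedC.
  by apply: trace_closure; rewrite yz.
exists (val @^-1` U).
  apply/set_nbhsP; exists (val @^-1` U); split=> //; first by exists U.
  by move=> x Cx; apply: PU; exists x.
move=> x clUx; apply: O'O; apply: contrapT => nO'x.
have Vx : V (val x) by apply: QV; exists x.
have [|y [Uy Vy]] := clUx (val @^-1` V).
  by apply: open_nbhs_nbhs; split=> //; exists V.
by have : (U `&` V) (val y) by []; rewrite UV.
Qed.

Theorem theorem5p7 (d : Order.disp_t) (omega1 : orderType d) :
  is_omega1 omega1 -> MA_omega1 omega1 ->
  forall S T : set omega1,
    stationary S -> S `<=` @Lim d omega1 ->
    stationary T -> T `<=` @Lim d omega1 ->
  forall (L1 : ladder_system S) (L2 : ladder_system T),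
    hereditarily_normal (ladder_space L1 * ladder_space L2)%type.
Proof.
move=> omega1W MA S T _ _ _ _ L1 L2.
apply: hereditarily_normal_separated => P Q.
apply: (MA_separated omega1W MA).
exact: slim_base_prod (slim_ladder_base L1 omega1W) (slim_ladder_base L2 omega1W).
Qed.
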